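(* For each $\epsilon>0$ there exist an infinite subsequence $\omega=(p_{b_j})_{j\ge1}$ ($b_1<b_2<\cdots$) of $p_0,p_1,p_2,\dots$ and a positive integer $K_0$ such that $r_N(\omega)<K_0$ for all $N\in\mathbb{Z}_{\ge0}$ and $b_j\ll j^{2+\epsilon}$ (i.e. $b_j\le C j^{2+\epsilon}$ for some constant $C$ and all $j$).
   Context: Let $q=p^s$ be a prime power and $\mathbb{F}_q$ the field with $q$ elements. Fix a bijection $\iota:\{0,1,\dots,q-1\}\to\mathbb{F}_q$ with $\iota(0)=0$. For $N\in\mathbb{Z}_{\ge0}$ with base-$q$ expansion $N=c_0+c_1q+\dots+c_nq^n$ ($0\le c_i<q$), put $p_N=\iota(c_0)+\iota(c_1)T+\dots+\iota(c_n)T^n\in\mathbb{F}_q[T]$; this gives a bijection $\mathbb{Z}_{\ge0}\to\mathbb{F}_q[T]$. For a subsequence $\omega$ of $p_0,p_1,\dots$ write $f\in\omega$ if $f$ occurs in $\omega$, and for $N\ge0$ define $r_N(\omega)=|\{(a,b)\in\mathbb{Z}_{\ge0}^2: p_a,p_b\in\omega,\ p_N=p_a+p_b,\ \deg p_a,\deg p_b\le\deg p_N,\ a<b\}|$, with $\deg 0=-\infty$. *)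

(* Defs.v *)
From HB Require Import structures.
From mathcomp Require Import all_boot all_order all_algebra finmap.
From mathcomp Require Import all_classical all_reals all_analysis.

Set Implicit Arguments.
Unset Strict Implicit.
Unset Printing Implicit Defensive.

Import Order.TTheory GRing.Theory Num.Theory.

Local Open Scope ring_scope.

Section DigitPolynomials.
Variable F : finFieldType.

Lemma card_field_gt0 : (0 < #|F|)%N.
Proof. by apply/card_gt0P; exists 0. Qed.

(* The coefficient of q ^ i in the base-q expansion of N, where q = #|F|. *)
Definition digit (N i : nat) : 'I_#|F| :=
  Ordinal (ltn_pmod (N %/ #|F| ^ i) card_field_gt0).

Variable iota : 'I_#|F| -> F.

(* Only the indices i <= N matter: q ^ i > N for i > N, so the other digits
   are 0, and iota is meant to send 0 to 0. *)
Definition digit_poly (N : nat) : {poly F} :=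
  \poly_(i < N.+1) iota (digit N i).

(* The degree conditions are expressed with size: size f = deg f + 1 for f != 0
   and size 0 = 0, which agrees with the convention deg 0 = -oo. *)
Definition rep_set (omega : nat -> {poly F}) (N : nat) : set (nat * nat) :=
  [set ab | [/\ range omega (digit_poly ab.1),
                range omega (digit_poly ab.2),
                digit_poly N = digit_poly ab.1 + digit_poly ab.2,
                (size (digit_poly ab.1) <= size (digit_poly N))%N /\
                (size (digit_poly ab.2) <= size (digit_poly N))%N
              & (ab.1 < ab.2)%N]]%classic.

(* fset_set is the empty set on infinite sets; rep_set is always finite when
   iota is a bijection fixing 0 (finite_rep_set below). *)
Definition rep_count (omega : nat -> {poly F}) (N : nat) : nat :=
  #|` fset_set (rep_set omega N)|.

Hypothesis iota_bij : bijective iota.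
Hypothesis iota0 : forall c : 'I_#|F|, c = 0%N :> nat -> iota c = 0.

Lemma coef_digit_poly N i : (digit_poly N)`_i = iota (digit N i).
Proof.
rewrite coef_poly; case: ltnP => // ltNi; rewrite iota0 //=.
rewrite divn_small ?mod0n // (ltn_trans ltNi) //.
exact: ltn_expl (card_finNzRing_gt1 F).
Qed.

Lemma ltn_size_digit_poly N n : (size (digit_poly N) <= n)%N -> (N < #|F| ^ n)%N.
Proof.
move=> leNn; case: (posnP N) => [->|N0]; first by rewrite expn_gt0 card_field_gt0.
have q1 := card_finNzRing_gt1 F; rewrite ltnNge; apply/negP => leqN.
have /andP[lek ltk] := trunc_log_bounds q1 N0.
set k := trunc_log _ _ in lek ltk.
have nk : (n <= k)%N by rewrite -ltnS -(ltn_exp2l _ _ q1) (leq_ltn_trans leqN).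
have /eqP := nth_default 0 (leq_trans leNn nk).
rewrite coef_digit_poly.
rewrite -(iota0 (c := Ordinal card_field_gt0)) // (inj_eq (bij_inj iota_bij)).
rewrite -val_eqE /= modn_small; last by rewrite ltn_divLR ?expn_gt0 ?card_field_gt0 // -expnS.
by rewrite -leqn0 leqNgt divn_gt0 ?expn_gt0 ?card_field_gt0 // lek.
Qed.

Lemma finite_rep_set omega N : finite_set (rep_set omega N).
Proof.
set M := (#|F| ^ size (digit_poly N))%N.
apply: (@sub_finite_set _ _ (`I_M `*` `I_M)%classic).
  move=> [a b] [_ _ _ [/= ha hb] _].
  by split; apply: ltn_size_digit_poly.
exact: finite_setX.
Qed.

End DigitPolynomials.

(* Main.v *)
(* Fix a large c and, for e = 1, 2, ..., add polynomials of degree exactly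
   d = (2c+4)e one at a time until the set A has q^(ce) elements in all; no
   other degrees occur.  A target N of degree d only sees sums involving a new
   element, so it starts with no representations.  Adding a random a of degree d
   creates a representation of N only when N - a is in A, which has probability
   about |A| / q^d; hence the potential sum_N z^(r_N), with z = q^e, grows on
   average by a factor at most 1 + z^2 |A| / q^d per step.  As z^2 |A|^2 is much
   smaller than q^d, some choice of the new elements keeps the potential below
   2 q^(d+1), which forces r_N <= 2c + 6.  The n-th element is then of size
   about n^((2c+4)/c), up to a constant. *)

Require Import Defs.
From HB Require Import structures.
From mathcomp Require Import all_boot all_order all_algebra finmap.
From mathcomp Require Import all_classical all_reals all_analysis.
From mathcomp Require Import zify.

Set Implicit Arguments.
Unset Strict Implicit.
Unset Printing Implicit Defensive.

Import Order.TTheory GRing.Theory Num.Theory.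

Local Open Scope ring_scope.

(** * Representation counts in an abelian group and their potential *)

Section Representations.
Variable G : zmodType.
Implicit Types (A B D : seq G) (N x a : G).
Local Open Scope nat_scope.

(** Both orders of a sum are counted: on a duplicate-free list this is twice the number of unordered
    representations by distinct elements. *)
Definition reps A N :=
  count [pred x | (N - x \in A)%R && (N - x != x)%R] A.

Lemma perm_reps A B N : perm_eq A B -> reps A N = reps B N.
Proof.
move=> AB; rewrite /reps (permP AB); apply: eq_count => x /=.
by rewrite (perm_mem AB).
Qed.

(** A new element [a] enters only the ordered pairs [(a, N - a)] and [(N - a, a)], hence the doubled
    indicator. *)
Lemma reps_cons A N a : uniq A ->
  reps (a :: A) N <= reps A N + (N - a \in A)%R.*2.
Proof.
move=> uA; rewrite {1}/reps /= inE.
have -> : (((N - a == a) || (N - a \in A)) && (N - a != a))%R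
  = ((N - a \in A) && (N - a != a))%R by case: eqP; rewrite ?andbF.
rewrite -addnn addnA addnC; apply: leq_add; last by case: (_ \in _); case: (_ != _).
rewrite -(count_uniq_mem (N - a)%R uA) /reps -count_predUI.
apply: leq_trans (leq_addr _ _); apply: sub_count => x /=.
rewrite inE; case/andP=> /orP[/eqP <-|->] -> /=; rewrite ?orbT //.
by rewrite subKr eqxx ?orbT.
Qed.

Lemma leq_count_sub A D N : uniq D ->
  count (fun a => N - a \in A)%R D <= size A.
Proof.
move=> uD; rewrite -size_filter -(size_map (fun a => N - a)%R).
apply: uniq_leq_size.
  by rewrite map_inj_uniq ?filter_uniq // => x y /addrI/oppr_inj.
by move=> _ /mapP[x + ->]; rewrite mem_filter => /andP[].
Qed.

Definition potential z D A := \sum_(N <- D) z ^ reps A N.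

(** After exchanging the sums, each [N] has at most [size A] candidates [a] that raise its count,
    and each of them costs a factor of at most [z ^ 2]. *)
Lemma sum_potential_cons z D A : 0 < z -> uniq D -> uniq A ->
  \sum_(a <- D | a \notin A) potential z D (a :: A) <=
  potential z D A * (count [predC A] D + z ^ 2 * size A).
Proof.
move=> z0 uD uA; rewrite /potential exchange_big big_distrl /=.
apply: leq_sum => N _.
apply: (@leq_trans (\sum_(a <- D | a \notin A)
    z ^ reps A N * (1 + z ^ 2 * (N - a \in A)%R))).
  apply: leq_sum => a _.
  apply: (@leq_trans (z ^ (reps A N + (N - a \in A)%R.*2))).
    by rewrite leq_pexp2l ?reps_cons.
  rewrite expnD leq_mul2l; case: (_ \in _); rewrite /= ?muln1 ?muln0 ?orbT //.
  by rewrite leq_addl orbT.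
rewrite -big_distrr /= leq_mul2l big_split /= sum1_count.
apply/orP; right; apply: leq_add => //.
rewrite -big_distrr leq_mul2l /=; apply/orP; right.
apply: leq_trans (leq_count_sub A N uD).
rewrite -sum1_count [leqRHS]big_mkcond [leqLHS]big_mkcond; apply: leq_sum => a _.
by case: (_ \in _); case: (_ \in _).
Qed.

(** Averaging over the candidates outside [A]: there are at least [2 * m * (z ^ 2 * size A)] of
    them, so the mean growth factor is at most [1 + 1/(2m)]. *)
Lemma exists_cons_small_potential z m D A : 0 < z -> 0 < m ->
  uniq D -> uniq A -> size A <= m -> m + 2 * z ^ 2 * m ^ 2 <= size D ->
  exists a, [/\ a \in D, a \notin A &
    potential z D (a :: A) * (2 * m) <= potential z D A * (2 * m).+1].
Proof.
move=> z0 m0 uD uA Am mD; apply: contrapT => none.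
set P := count [predC A] D.
have DP : size D <= P + size A.
  rewrite -(count_predC [in A] D) addnC leq_add2l.
  rewrite -size_filter uniq_leq_size ?filter_uniq // => x.
  by rewrite mem_filter => /andP[].
have zm : 0 < z ^ 2 * m ^ 2 by rewrite muln_gt0 !expn_gt0 z0 m0.
have PA : 2 * m * (z ^ 2 * size A) <= P.
  have : z ^ 2 * m * size A <= z ^ 2 * m * m by rewrite leq_mul2l Am orbT.
  nia.
have P0 : 0 < P by lia.
have big a : a \in D -> a \notin A ->
    (potential z D A * (2 * m).+1).+1 <= potential z D (a :: A) * (2 * m).
  by move=> aD aA; rewrite ltnNge; apply/negP => le; apply: none; exists a.
have : P * (potential z D A * (2 * m).+1).+1 <=
    (\sum_(a <- D | a \notin A) potential z D (a :: A)) * (2 * m).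
  rewrite /P -sum1_count [leqLHS]big_distrl [leqRHS]big_distrl /=.
  rewrite [leqLHS]big_seq_cond [leqRHS]big_seq_cond.
  by apply: leq_sum => a /andP[aD aA]; rewrite mul1n big.
have := sum_potential_cons z0 uD uA; rewrite -/P.
set S := \sum_(a <- D | _) _; set V := potential z D A => h1 h2.
have : S * (2 * m) <= V * (P + z ^ 2 * size A) * (2 * m) by rewrite leq_mul2r h1 orbT.
have : V * (2 * m * (z ^ 2 * size A)) <= V * P by rewrite leq_mul2l PA orbT.
nia.
Qed.

Lemma extend_few_reps z m D A : 0 < z -> 0 < m ->
  uniq D -> uniq A -> size A <= m -> m + 2 * z ^ 2 * m ^ 2 <= size D ->
  (forall N, N \in D -> reps A N = 0) ->
  exists B, [/\ {subset B <= D}, uniq (B ++ A), size (B ++ A) = m &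
    forall N, N \in D -> z ^ reps (B ++ A) N <= 2 * size D].
Proof.
move=> z0 m0 uD uA Am mD rA0.
(* The initial potential is [size D]; [k] steps multiply it by at most [2m / (2m - k)], which is at
   most 2 since [k <= m]. *)
suff H k : size A + k <= m -> exists B, [/\ {subset B <= D}, uniq (B ++ A),
    size B = k & potential z D (B ++ A) * (2 * m - k) <= size D * (2 * m)].
  have [|B [BD uBA sB le]] := H (m - size A); first by rewrite subnKC.
  exists B; split=> //; first by rewrite size_cat sB subnK.
  move=> N ND; apply: (@leq_trans (potential z D (B ++ A))).
    by rewrite /potential (bigD1_seq N) //= leq_addr.
  have : potential z D (B ++ A) * m <= size D * (2 * m).
    by apply: leq_trans le; rewrite leq_mul2l; lia.
  by rewrite mulnA [size D * 2]mulnC leq_pmul2r.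
elim: k => [|k IH] km.
  exists [::]; split=> //; rewrite cat0s subn0 leq_mul2r; apply/orP; right.
  rewrite /potential big_seq (eq_bigr (fun=> 1)) => [|N ND]; last by rewrite rA0.
  by rewrite -big_seq sum1_size.
have [|B [BD uBA sB le]] := IH; first by lia.
have sBA : size (B ++ A) <= m by rewrite size_cat sB; lia.
have [a [aD aBA lea]] := exists_cons_small_potential z0 m0 uD uBA sBA mD.
exists (a :: B); split=> /=; rewrite ?aBA ?sB //.
  by move=> x; rewrite inE => /predU1P[->|/BD].
(* (1 + 1/(2m)) (2m - k - 1) <= 2m - k, so the bound survives a step *)
move: le lea; rewrite -!cat_cons.
set V' := potential z D (a :: _); set V := potential z D _ => le lea.
have m2 : 0 < 2 * m by lia.
rewrite -(leq_pmul2r m2).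
apply: (@leq_trans (V * (2 * m).+1 * (2 * m - k.+1))).
  by rewrite mulnAC leq_mul2r lea orbT.
apply: (@leq_trans (V * (2 * m - k) * (2 * m))); last by rewrite leq_mul2r le orbT.
by rewrite -!mulnA leq_mul2l; apply/orP; right; nia.
Qed.

End Representations.

(** * Digit polynomials: index ranges and degrees *)

Section DigitPolynomialTheory.
Variables (F : finFieldType) (iota : 'I_#|F| -> F).
Hypothesis iota_bij : bijective iota.
Hypothesis iota0 : forall c : 'I_#|F|, c = 0%N :> nat -> iota c = 0.
Local Open Scope nat_scope.

Local Notation q := #|F|.
Local Notation p := (digit_poly iota).

Let q_gt1 : 1 < q := card_finNzRing_gt1 F.
Let q_gt0 : 0 < q := ltnW q_gt1.

Lemma size_digit_poly_leq N n : (size (p N) <= n) = (N < q ^ n).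
Proof.
apply/idP/idP => [/(ltn_size_digit_poly iota_bij iota0)//|Nn].
apply/leq_sizeP => i ni; rewrite coef_digit_poly // iota0 //=.
by rewrite divn_small ?mod0n // (leq_trans Nn) // leq_exp2l.
Qed.

(** Equal digits give equal residues modulo every power of [q], and modulo [q ^ maxn a b] the
    residues are [a] and [b] themselves. *)
Lemma digit_poly_inj : injective p.
Proof.
move=> a b /polyP ab.
have dig i : (a %/ q ^ i) %% q = (b %/ q ^ i) %% q.
  have := ab i; rewrite !coef_digit_poly //.
  by move=> /(bij_inj iota_bij) [].
have modE n : a %% q ^ n = b %% q ^ n.
  elim: n => [|n IH]; first by rewrite !modn1.
  have E x : x %% q ^ n.+1 = (x %/ q ^ n) %% q * q ^ n + x %% q ^ n.
    rewrite {1}(divn_eq x (q ^ n)) {1}(divn_eq (x %/ q ^ n) q).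
    rewrite mulnDl -mulnA -expnS -addnA modnMDl modn_small //.
    have := ltn_pmod (x %/ q ^ n) q_gt0.
    have := ltn_pmod x (_ : 0 < q ^ n); rewrite expn_gt0 q_gt0 => /(_ isT).
    rewrite expnS; nia.
  by rewrite !E dig IH.
have := modE (maxn a b); rewrite !modn_small //.
- by apply: leq_ltn_trans (leq_maxr a b) _; rewrite ltn_expl.
- by apply: leq_ltn_trans (leq_maxl a b) _; rewrite ltn_expl.
Qed.

(** Indices from [q ^ d] up to [q ^ d.+1] (excluded) are the polynomials of degree exactly [d].
    Those of [s] have smaller degree, so their sums never reach degree [d] and all counts start at
    0. *)
Lemma extend_degree d z m (s : seq nat) : 0 < z -> 0 < m ->
  sorted ltn s -> all (fun x => x < q ^ d) s -> size s <= m ->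
  m + 2 * z ^ 2 * m ^ 2 <= q ^ d ->
  exists t, [/\ sorted ltn (s ++ t), size (s ++ t) = m,
    all (fun x => q ^ d <= x < q ^ d.+1) t &
    forall N, q ^ d <= N < q ^ d.+1 ->
      z ^ reps (map p (s ++ t)) (p N) <= 2 * q ^ d.+1].
Proof.
move=> z0 m0 ss /allP sd sm mq.
set I := index_iota (q ^ d) (q ^ d.+1).
have pI (r : seq nat) : uniq r -> uniq (map p r).
  by rewrite (map_inj_uniq digit_poly_inj).
have us : uniq s by rewrite (sorted_uniq ltn_trans ltnn).
have uI : uniq I by rewrite iota_uniq.
have sI : size (map p I) = q ^ d.+1 - q ^ d by rewrite size_map size_iota.
have le_sI : q ^ d <= size (map p I).
  by rewrite sI expnS; nia.
have [||B [BD uBA sBA le]] :=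
  extend_few_reps z0 m0 (pI _ uI) (pI _ us) _ (leq_trans mq le_sI).
- by rewrite size_map.
- move=> _ /mapP[N + ->]; rewrite mem_index_iota ltnNge => /andP[dN _].
  apply/eqP; rewrite eqn0Ngt -has_count; apply: contraL dN.
  case/hasP=> _ /mapP[x xs ->] /= /andP[/mapP[y ys Ny] _].
  rewrite -ltnNge -size_digit_poly_leq -(subrK (p x) (p N)) Ny.
  by rewrite (leq_trans (size_polyD _ _)) // geq_max !size_digit_poly_leq !sd.
(* Filtering the increasing list [I] puts the indices of [B] in order; [reps] does not see the
   permutation. *)
pose t := [seq x <- I | p x \in B].
have tB : perm_eq (map p t) B.
  apply: uniq_perm; first by rewrite pI // filter_uniq.
    by move: uBA; rewrite cat_uniq => /andP[].
  move=> f; apply/mapP/idP => [[x + ->]|fB]; first by rewrite mem_filter => /andP[].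
  by have /mapP[x xI fx] := BD f fB; exists x => //; rewrite mem_filter -fx fB.
have st : perm_eq (map p (s ++ t)) (B ++ map p s).
  by rewrite map_cat perm_catC perm_cat2r.
have tI : {in t, forall x, q ^ d <= x < q ^ d.+1}.
  by move=> x; rewrite mem_filter mem_index_iota => /andP[].
exists t; split.
- rewrite sorted_pairwise; last exact: ltn_trans.
  rewrite pairwise_cat -!(sorted_pairwise ltn_trans) ss /=.
  rewrite sorted_filter ?iota_ltn_sorted // ?andbT; last exact: ltn_trans.
  by apply/allrelP => x y /sd xd /tI/andP[dy _]; apply: leq_trans dy.
- by rewrite -sBA -(perm_size st) size_map.
- exact/allP.
- move=> N Nd; rewrite (perm_reps _ st) (leq_trans (le _ _)) //.
    by rewrite map_f // mem_index_iota.
  by rewrite leq_mul2l sI leq_subr orbT.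
Qed.

(** * Stagewise construction of the set *)

Section Stages.
Variable c : nat.

Definition stage e s := [/\ sorted ltn s, size s = q ^ (c * e) &
  all (fun x => x < q ^ ((2 * c + 4) * e).+1) s].

(** Uses [z = q ^ e.+1] and [m = q ^ (c * e.+1)]. A count [r] satisfies
    [z ^ r <= 2 * q ^ d.+1 <= q ^ d.+2], so [e.+1 * r <= d + 2], whence [r <= 2 * c + 6]. *)
Lemma stage_extension e s : stage e s -> exists t, [/\ stage e.+1 (s ++ t),
  all (fun x => q ^ ((2 * c + 4) * e.+1) <= x) t &
  forall N, q ^ ((2 * c + 4) * e.+1) <= N < q ^ ((2 * c + 4) * e.+1).+1 ->
    reps (map p (s ++ t)) (p N) <= 2 * c + 6].
Proof.
move=> [ss sizes /allP sd]; set d := (2 * c + 4) * e.+1.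
have sd' : all (fun x => x < q ^ d) s.
  by apply/allP => x /sd /leq_trans-> //; rewrite leq_exp2l // /d; lia.
have X0 n : 0 < q ^ n by rewrite expn_gt0 q_gt0.
have [||t [sst sizest td H]] := extend_degree (X0 e.+1) (X0 (c * e.+1)) ss sd'.
- by rewrite sizes leq_exp2l //; lia.
(* Both summands are at most [q ^ d.-1], the second because [2 <= q] and
   [1 + (2 * c + 2) * e.+1 <= d.-1]. *)
- apply: (@leq_trans (q ^ d.-1 + q ^ d.-1)).
    apply: leq_add; first by rewrite leq_exp2l // /d; lia.
    apply: (@leq_trans (q * (q ^ e.+1) ^ 2 * (q ^ (c * e.+1)) ^ 2)).
      by rewrite !leq_mul2r q_gt1 !orbT.
    by rewrite -!expnM -expnS -expnD leq_exp2l // /d; lia.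
  rewrite addnn -mul2n (@leq_trans (q * q ^ d.-1)) ?leq_mul2r ?q_gt1 ?orbT //.
  by rewrite -expnS prednK // /d; lia.
exists t; split.
- split=> //; rewrite all_cat; apply/andP; split.
    by apply: sub_all sd' => x /leq_trans-> //; rewrite leq_exp2l.
  by apply: sub_all td => x /andP[].
- by apply: sub_all td => x /andP[].
move=> N /H; rewrite -expnM => le.
have : q ^ (e.+1 * reps (map p (s ++ t)) (p N)) <= q ^ d.+2.
  by apply: leq_trans le _; rewrite [leqRHS]expnS leq_mul2r q_gt1 orbT.
rewrite leq_exp2l // /d; set r := reps _ _ => rd.
have : e.+1 * r <= e.+1 * (2 * c + 6) by lia.
by rewrite leq_pmul2l.
Qed.

Lemma exists_stages : exists S : nat -> seq nat, [/\ S 0 = [:: 0],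
  forall e, stage e (S e),
  forall e, exists2 t, S e.+1 = S e ++ t &
    all (fun x => q ^ ((2 * c + 4) * e.+1) <= x) t &
  forall e N, q ^ ((2 * c + 4) * e.+1) <= N < q ^ ((2 * c + 4) * e.+1).+1 ->
    reps (map p (S e.+1)) (p N) <= 2 * c + 6].
Proof.
(* With the implication inside the existential, [choice] yields a total function to iterate; its
   value off stages is irrelevant. *)
have H (es : nat * seq nat) : exists t, stage es.1 es.2 ->
    [/\ stage es.1.+1 (es.2 ++ t),
     all (fun x => q ^ ((2 * c + 4) * es.1.+1) <= x) t &
     forall N, q ^ ((2 * c + 4) * es.1.+1) <= N < q ^ ((2 * c + 4) * es.1.+1).+1 ->
       reps (map p (es.2 ++ t)) (p N) <= 2 * c + 6].
  have [/stage_extension[t Ht]|ns] := pselect (stage es.1 es.2); first by exists t.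
  by exists [::] => /ns.
have [f Hf] := choice H.
pose S := nat_rec (fun=> seq nat) [:: 0] (fun e s => s ++ f (e, s)).
have S0 : stage 0 (S 0) by rewrite /stage !muln0 /= expn1 q_gt0.
have stS e : stage e (S e) by elim: e => // e /(Hf (e, S e))[].
exists S; split=> // e.
- by exists (f (e, S e)) => //; have [] := Hf (e, S e) (stS e).
- by have [] := Hf (e, S e) (stS e).
Qed.

End Stages.

End DigitPolynomialTheory.

(** * Nested lists and the growth exponent *)

Lemma prefix_chain (S : nat -> seq nat) :
  (forall e, exists t, S e.+1 = S e ++ t) ->
  forall e e', (e <= e')%N -> exists t, S e' = S e ++ t.
Proof.
move=> H e e' /subnKC <-; elim: (e' - e)%N => [|k [t IH]].
  by exists [::]; rewrite addn0 cats0.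
by have [u] := H (e + k)%N; rewrite addnS IH -catA => ->; exists (t ++ u).
Qed.

(** Since [2 * c + 4 <= c * (2 + eps)], the power [y ^ (2 * c + 4)] is at most
    [(y ^ c) ^ (2 + eps)]. *)
Lemma natr_le_powR (R : realType) (eps : R) (c n y j : nat) :
  (0 < y)%N -> 4 <= c%:R * eps -> (n <= y ^ (2 * c + 4))%N ->
  (y ^ c <= j.+1)%N -> n%:R <= j.+1%:R `^ (2 + eps).
Proof.
move=> y0 c4 ny yj.
have y1 : 1 <= y%:R :> R by rewrite ler1n.
have yge0 : 0 <= y%:R :> R by rewrite ler0n.
have eps0 : 0 <= eps.
  rewrite leNgt; apply/negP => eps0.
  have := mulr_ge0_le0 (ler0n R c) (ltW eps0).
  by move=> /(le_trans c4); rewrite leNgt ltr0n.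
apply: (@le_trans _ _ ((y ^ c)%:R `^ (2 + eps))); last first.
  by apply: ge0_ler_powR; rewrite ?addr_ge0 ?nnegrE ?ler0n ?ler_nat.
apply: (@le_trans _ _ ((y ^ (2 * c + 4))%:R)); first by rewrite ler_nat.
rewrite !natrX -!powR_mulrn // -powRrM ler_powR //.
by rewrite natrD natrM mulrDr mulrC lerD2l.
Qed.

(** * The increasing enumeration of the union of the stages *)

Section StageEnumeration.
Variables (F : finFieldType) (iota : 'I_#|F| -> F).
Hypothesis iota_bij : bijective iota.
Hypothesis iota0 : forall c : 'I_#|F|, c = 0%N :> nat -> iota c = 0.
Local Open Scope nat_scope.

Local Notation q := #|F|.
Local Notation p := (digit_poly iota).

Variables (c : nat) (S : nat -> seq nat).
Hypothesis c_gt0 : 0 < c.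
Hypothesis S0 : S 0 = [:: 0].
Hypothesis stageS : forall e, stage F c e (S e).
Hypothesis S_ext : forall e, exists2 t, S e.+1 = S e ++ t &
  all (fun x => q ^ ((2 * c + 4) * e.+1) <= x) t.
Hypothesis repsS : forall e N,
  q ^ ((2 * c + 4) * e.+1) <= N < q ^ ((2 * c + 4) * e.+1).+1 ->
  reps (map p (S e.+1)) (p N) <= 2 * c + 6.

(** Stage [j] has [q ^ (c * j) > j] entries, so the default 0 is never reached, and later stages
    keep entry [j]. *)
Definition diagonal j := nth 0 (S j) j.

Let q_gt1 : 1 < q := card_finNzRing_gt1 F.

Let prefS e e' : e <= e' -> exists t, S e' = S e ++ t.
Proof. by apply: prefix_chain => k; have [t ->] := S_ext k; exists t. Qed.

Let sizeS e : size (S e) = q ^ (c * e).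
Proof. by have [] := stageS e. Qed.

Let ltn_sizeS j : j < size (S j).
Proof.
rewrite sizeS; apply: leq_trans (ltn_expl j q_gt1) _.
by rewrite leq_exp2l // leq_pmull.
Qed.

Lemma diagonalE e j : j < size (S e) -> diagonal j = nth 0 (S e) j.
Proof.
move=> je; rewrite /diagonal.
case: (leqP j e) => [/prefS[t ->]|/ltnW/prefS[t ->]].
  by rewrite nth_cat ltn_sizeS.
by rewrite nth_cat je.
Qed.

Lemma diagonal_homo : {homo diagonal : i j / i < j}.
Proof.
apply: homo_ltn => [y x z|i]; first exact: ltn_trans.
have i1 := ltn_sizeS i.+1; have i0 := ltnW i1.
rewrite (diagonalE i0) (diagonalE i1).
by have [ss _ _] := stageS i.+1; apply: (sorted_ltn_nth ltn_trans).
Qed.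

(** Take the first stage containing both summands; it is not stage 0, as [a < b]. One summand is new
    there, so it has the full degree of that stage, and the degree conditions rule out cancellation
    in the sum. *)
Lemma rep_set_stage N ab : rep_set iota (p \o diagonal) N ab ->
  exists e, [/\ size (p N) = ((2 * c + 4) * e.+1).+1,
    ab.1 \in S e.+1 & ab.2 \in S e.+1].
Proof.
case: ab => a b [/= [i _ /(digit_poly_inj iota_bij iota0) ia]].
move=> [j _ /(digit_poly_inj iota_bij iota0) jb] Nab [aN bN] ab.
have ex : exists e, (a \in S e) && (b \in S e).
  exists (maxn i j).
  have [t Ei] := prefS (leq_maxl i j); have [u Ej] := prefS (leq_maxr i j).
  by rewrite {1}Ei Ej !mem_cat -ia -jb /diagonal !mem_nth.
case: (ex_minnP ex) => -[|e]; first by rewrite S0 !inE; lia.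
move=> /andP[ae be] min; exists e; split=> //.
apply/eqP; rewrite eqn_leq; apply/andP; split.
  have [_ _ /allP sS] := stageS e.+1.
  by rewrite Nab (leq_trans (size_polyD _ _)) // geq_max
             !size_digit_poly_leq // !sS.
have [t St /allP ht] := S_ext e.
have big x : x \in S e.+1 -> x \notin S e -> (2 * c + 4) * e.+1 < size (p x).
  rewrite St mem_cat => /orP[->//|/ht xt _].
  by rewrite ltnNge size_digit_poly_leq // -leqNgt.
have : ~~ ((a \in S e) && (b \in S e)).
  by apply/negP => /min; rewrite ltnn.
rewrite negb_and => /orP[/(big _ ae)|/(big _ be)] /leq_trans; exact.
Qed.

(** The degree of [N] determines the stage, so all its representations lie in a single [S e.+1],
    where [(a, b)] is recovered from [p a]. *)
Lemma rep_count_diagonal N : rep_count iota (p \o diagonal) N < 2 * c + 7.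
Proof.
rewrite /rep_count addnS ltnS.
set r := fset_set _.
have rP ab : ab \in r -> rep_set iota (p \o diagonal) N ab.
  rewrite in_fset_set ?inE //; exact: finite_rep_set.
case: (fset_0Vmem r) => [->|[ab abr]]; first by rewrite cardfs0; lia.
have [e [sN _ _]] := rep_set_stage (rP _ abr).
have Ne : q ^ ((2 * c + 4) * e.+1) <= N < q ^ ((2 * c + 4) * e.+1).+1.
  by rewrite leqNgt -!(size_digit_poly_leq iota_bij iota0) sN ltnn leqnn.
apply: leq_trans (repsS Ne); rewrite /reps -size_filter.
rewrite -(size_map (fun ab => p ab.1)); apply: uniq_leq_size.
  rewrite map_inj_in_uniq ?fset_uniq // => -[a b] [a' b'] /rP[_ _ /= E _ _].
  move=> /rP[_ _ /= E' _ _] aa'; move: E'; rewrite E aa' => /addrI.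
  move=> /(digit_poly_inj iota_bij iota0)->.
  by move/(digit_poly_inj iota_bij iota0): aa' => ->.
move=> _ /mapP[[a b] /rP abN ->] /=; rewrite mem_filter /=.
have [e' [sN' ae be]] := rep_set_stage abN.
have -> : e = e' by move: sN'; rewrite sN => -[]; nia.
have [_ _ -> _ /= ab'] := abN.
rewrite addrC addKr !map_f // (inj_eq (digit_poly_inj iota_bij iota0)).
by rewrite andbT /= gtn_eqF.
Qed.

(** If [S e.+1] is the first stage reaching index [j], then [y = q ^ e] satisfies [y ^ c <= j],
    while the entry is below [q ^ ((2 * c + 4) * e.+1).+1 = q ^ (2 * c + 5) * y ^ (2 * c + 4)]. *)
Lemma diagonal_bound (R : realType) (eps : R) : (4 <= c%:R * eps)%R ->
  exists C : R, forall j, ((diagonal j)%:R <= C * j.+1%:R `^ (2 + eps))%R.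
Proof.
move=> c4; exists (q ^ (2 * c + 5))%:R%R => j.
have ex : exists e, j < size (S e) by exists j.
have pos y : 0 < y -> y ^ c <= j.+1 ->
    diagonal j <= q ^ (2 * c + 5) * y ^ (2 * c + 4) ->
    ((diagonal j)%:R <= (q ^ (2 * c + 5))%:R * j.+1%:R `^ (2 + eps) :> R)%R.
  move=> y0 yj; rewrite -(ler_nat R) natrM => /le_trans; apply.
  by rewrite ler_wpM2l // (natr_le_powR y0 c4 _ yj).
case: (ex_minnP ex) => -[|e] je min.
  apply: (pos 1) => //; first by rewrite exp1n.
  by rewrite (diagonalE je); move: je; rewrite S0; case: j {ex min pos}.
apply: (pos (q ^ e)); first by rewrite expn_gt0 ltnW.
  have : ~~ (j < size (S e)) by apply/negP => /min; rewrite ltnn.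
  by rewrite -leqNgt sizeS -expnM mulnC => /leq_trans; apply.
rewrite (diagonalE je); have [_ _ /allP sS] := stageS e.+1.
apply/ltnW/(leq_trans (sS _ (mem_nth 0 je))).
by rewrite -expnM -expnD leq_exp2l //; lia.
Qed.

End StageEnumeration.

Theorem theorem3p2 (R : realType) (F : finFieldType)
    (iota : 'I_#|F| -> F) (iota_bij : bijective iota)
    (iota0 : forall c : 'I_#|F|, c = 0%N :> nat -> iota c = 0)
    (eps : R) (eps_gt0 : 0 < eps) :
  exists (b : nat -> nat) (K0 : nat),
    [/\ {homo b : i j / (i < j)%N},
        (0 < K0)%N,
        forall N : nat, (rep_count iota (digit_poly iota \o b) N < K0)%N
      & exists C : R, forall j : nat,
          (b j)%:R <= C * (j.+1)%:R `^ (2 + eps)].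
Proof.
(* Any [c >= 4 / eps] makes the exponent [(2c + 4) / c] at most [2 + eps]. *)
pose c := (Num.truncn (4 / eps)).+1.
have c4 : 4 <= c%:R * eps by rewrite -ler_pdivrMr // ltW // truncnS_gt.
have [S [S0 stS extS repsS]] := exists_stages iota_bij iota0 c.
exists (diagonal S), (2 * c + 7)%N; split.
- exact: diagonal_homo stS extS.
- by rewrite addnS.
- by apply: rep_count_diagonal stS extS repsS.
- exact: diagonal_bound stS extS _ _ c4.
Qed.
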